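(* Let $\mathcal{X}$ be a complex Banach space with $\dim \mathcal{X}\geq 2$, let $\mathcal{U}\subseteq B(\mathcal{X})$ be a standard operator algebra containing the identity operator $I$, let $n\geq 2$ be a fixed integer, and let $\phi:\mathcal{U}\rightarrow\mathcal{U}$ be a linear map. The following are equivalent: (i) $\phi$ satisfies $\mathbf{(T)}$; (ii) $\phi$ satisfies $\mathbf{(T_l)}$; (iii) $\phi$ satisfies $\mathbf{(T_r)}$; (iv) there exist an element $\lambda\in\mathbb{C}$ and a linear map $\mu:\mathcal{U}\rightarrow\mathbb{C}$ such that $\phi(A)=\lambda A+\mu(A)I$ for all $A\in\mathcal{U}$ and $\mu(p_n(A_1,A_2,\dots,A_n))=0$ for all $A_1,A_2,\dots,A_n\in\mathcal{U}$ with $A_1A_2=0$.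
   Context: All algebras and vector spaces are over $\mathbb{C}$. For a complex Banach space $\mathcal{X}$, $B(\mathcal{X})$ is the algebra of all bounded linear operators on $\mathcal{X}$ and $F(\mathcal{X})$ is its ideal of finite rank operators. A standard operator algebra over $\mathcal{X}$ is any subalgebra of $B(\mathcal{X})$ containing $F(\mathcal{X})$ (no closedness is assumed). For elements of an algebra $\mathcal{U}$, $[a,b]=ab-ba$, and $p_n$ is defined recursively by $p_1(a_1)=a_1$ and $p_n(a_1,\dots,a_n)=[p_{n-1}(a_1,\dots,a_{n-1}),a_n]$ for $n\geq 2$. For a fixed integer $n\geq 2$ and a linear map $\phi:\mathcal{U}\to\mathcal{U}$, consider the following conditions: - $\mathbf{(T_l)}$: $\phi(p_n(a_1,a_2,\dots,a_n))=p_n(\phi(a_1),a_2,\dots,a_n)$ for all $a_1,\dots,a_n\in\mathcal{U}$ with $a_1a_2=0$. - $\mathbf{(T_r)}$: $\phi(p_n(a_1,a_2,\dots,a_n))=p_n(a_1,\phi(a_2),a_3,\dots,a_n)$ for all $a_1,\dots,a_n\in\mathcal{U}$ with $a_1a_2=0$. - $\mathbf{(T)}$: both $\mathbf{(T_l)}$ and $\mathbf{(T_r)}$ hold. *)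

(* Defs.v *)
From HB Require Import structures.
From mathcomp Require Import all_boot all_order all_algebra.
From mathcomp Require Import boolp classical_sets functions reals.
From mathcomp Require Import topology normedtype.
Set Implicit Arguments.
Unset Strict Implicit.
Unset Printing Implicit Defensive.
Import Order.TTheory GRing.Theory Num.Theory numFieldNormedType.Exports.
Local Open Scope ring_scope.
Local Open Scope classical_set_scope.

Section Conditions.
Variable A : pzRingType.
Implicit Types (a b : A) (s : seq A) (phi : A -> A) (n : nat).

Definition lie_bracket a b : A := a * b - b * a.

(* p_n(a_1, ..., a_n) for s = [:: a_1; ...; a_n]; the value on the empty
   sequence is a dummy. *)
Definition lie_p s : A :=
  if s is a :: s' then foldl lie_bracket a s' else 0.

Lemma lie_p1 a : lie_p [:: a] = a.
Proof. by []. Qed.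

Lemma lie_p_rcons a s b :
  lie_p (rcons (a :: s) b) = lie_bracket (lie_p (a :: s)) b.
Proof. by rewrite /= foldl_rcons. Qed.

(* Meaningful for 2 <= n: s lists the n - 2 arguments a_3, ..., a_n. *)
Definition cond_Tl n phi : Prop :=
  forall (a1 a2 : A) (s : (n - 2).-tuple A), a1 * a2 = 0 ->
    phi (lie_p [:: a1, a2 & s]) = lie_p [:: phi a1, a2 & s].

Definition cond_Tr n phi : Prop :=
  forall (a1 a2 : A) (s : (n - 2).-tuple A), a1 * a2 = 0 ->
    phi (lie_p [:: a1, a2 & s]) = lie_p [:: a1, phi a2 & s].

Definition cond_T n phi : Prop := cond_Tl n phi /\ cond_Tr n phi.

End Conditions.

Definition dim_ge (K : numFieldType) (X : lmodType K) (d : nat) : Prop :=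
  exists e : 'I_d -> X, forall c : 'I_d -> K,
    \sum_(i < d) c i *: e i = 0 -> forall i, c i = 0.

Section BoundedOperators.
Variables (K : numFieldType) (X : normedModType K).

(* Norms take values in K; for K = R[i] the order is the partial one for which
   0 <= z means that z is real and nonnegative. *)
Definition bounded_linear (T : X -> X) : Prop :=
  linear T /\ exists M : K, forall x, `|T x| <= M * `|x|.

Definition bounded_linear_pred : {pred X -> X} := fun T => `[< bounded_linear T >].

Lemma bounded_linear_submod : submod_closed bounded_linear_pred.
Proof.
split=> [|k S T /asboolP[linS [M hM]] /asboolP[linT [N hN]]]; apply/asboolP.
  have E x : (0 : X -> X) x = 0 by [].
  split=> [k x y|]; first by rewrite !E scaler0 addr0.
  by exists 0 => x; rewrite E normr0 mul0r.
have E x : (k *: S + T) x = k *: S x + T x by [].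
split=> [l x y|].
  rewrite !E linS linT !scalerDr !scalerA [k * l]mulrC.
  by rewrite -!addrA; congr (_ + _); rewrite addrCA.
exists (`|k| * M + N) => x; rewrite E mulrDl -mulrA.
apply: le_trans (ler_normD _ _) _; rewrite normrZ.
by apply: lerD => //; apply: ler_wpM2l.
Qed.

HB.instance Definition _ :=
  GRing.isSubmodClosed.Build K (X -> X) bounded_linear_pred bounded_linear_submod.

(* B(X), with the pointwise vector space structure of X -> X and with
   composition as product. *)
Record bop := Bop { bop_fun :> X -> X; _ : bop_fun \in bounded_linear_pred }.

HB.instance Definition _ := [isSub for bop_fun].
HB.instance Definition _ := [Choice of bop by <:].
HB.instance Definition _ := [SubChoice_isSubLmodule of bop by <:].

Lemma bopP (T : bop) : bounded_linear T.
Proof. by case: T => T T_bl; exact/asboolP. Qed.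

Lemma bop_ext (S T : bop) : S =1 T -> S = T.
Proof. by move=> ST; apply/val_inj/funext. Qed.

Lemma bop_id_subproof : (@idfun X) \in bounded_linear_pred.
Proof. by apply/asboolP; split=> //; exists 1 => x; rewrite mul1r. Qed.

Lemma bop_comp_subproof (S T : bop) : (S \o T) \in bounded_linear_pred.
Proof.
have [linS [M hM]] := bopP S; have [linT [N hN]] := bopP T.
apply/asboolP; split=> [k x y|]; first by rewrite /= linT linS.
have [[x0 x0N0]|noX] := pselect (exists x : X, x != 0); last first.
  have X0 (x : X) : x = 0.
    by have [//|xN0] := eqVneq x 0; case: noX; exists x.
  by exists 0 => x; rewrite [(S \o T) x]X0 normr0 mul0r.
have M0 : 0 <= M.
  have := le_trans (normr_ge0 _) (hM x0).
  by rewrite pmulr_lge0 // normr_gt0.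
exists (M * N) => x /=; apply: le_trans (hM _) _.
by rewrite -mulrA; apply: ler_wpM2l.
Qed.

Definition bop_id : bop := Bop bop_id_subproof.
Definition bop_comp (S T : bop) : bop := Bop (bop_comp_subproof S T).

Lemma bop_compA : associative bop_comp.
Proof. by move=> S T V; apply: bop_ext. Qed.
Lemma bop_comp1l : left_id bop_id bop_comp.
Proof. by move=> S; apply: bop_ext. Qed.
Lemma bop_comp1r : right_id bop_id bop_comp.
Proof. by move=> S; apply: bop_ext. Qed.
Lemma bop_compDl : left_distributive bop_comp +%R.
Proof. by move=> S T V; apply: bop_ext. Qed.
Lemma bop_compDr : right_distributive bop_comp +%R.
Proof.
move=> S T V; apply: bop_ext => x; have [linS _] := bopP S.
by have := linS 1 (T x) (V x); rewrite !scale1r.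
Qed.

(* X may be the zero space, so the ring is not required to satisfy 1 != 0. *)
HB.instance Definition _ := GRing.Zmodule_isPzRing.Build bop
  bop_compA bop_comp1l bop_comp1r bop_compDl bop_compDr.

Definition finite_rank (T : bop) : Prop :=
  exists (d : nat) (e : 'I_d -> X), forall x, exists c : 'I_d -> K,
    T x = \sum_(i < d) c i *: e i.

(* A subalgebra need not contain the identity. *)
Definition subalgebra (U : set bop) : Prop :=
  [/\ U 0,
      forall (k : K) S T, U S -> U T -> U (k *: S + T)
    & forall S T, U S -> U T -> U (S * T)].

Definition standard_operator_algebra (U : set bop) : Prop :=
  subalgebra U /\ (forall T, finite_rank T -> U T).

Section Unital.
Variables (U : set bop) (stdU : standard_operator_algebra U) (U1 : U 1).

Definition soa_pred (_ : standard_operator_algebra U) (_ : U 1) :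
    {pred bop} :=
  fun T => `[< U T >].

Notation pU := (soa_pred stdU U1).

Lemma soa_submod_closed : submod_closed pU.
Proof.
have [[U0 UZD _] _] := stdU; split=> [|k S T /asboolP US /asboolP UT].
  exact/asboolP.
exact/asboolP/UZD.
Qed.

HB.instance Definition _ :=
  GRing.isSubmodClosed.Build K bop pU soa_submod_closed.

Lemma soa_subring_closed : subring_closed pU.
Proof.
have [[_ UZD UM] _] := stdU; split=> [|S T /asboolP US /asboolP UT|].
- exact/asboolP.
- by apply/asboolP; rewrite addrC -scaleN1r; apply: UZD.
- by move=> S T /asboolP US /asboolP UT; exact/asboolP/UM.
Qed.

(* U itself, as a vector space and a ring with unit the identity operator. *)
Record soa := Soa { soa_val :> bop; _ : soa_val \in pU }.

HB.instance Definition _ := [isSub for soa_val].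
HB.instance Definition _ := [Choice of soa by <:].
HB.instance Definition _ := [SubChoice_isSubLmodule of soa by <:].
HB.instance Definition _ :=
  GRing.SubZmodule_isSubPzRing.Build bop pU soa soa_subring_closed.

End Unital.
End BoundedOperators.

(* Main.v *)
Require Import Defs.
From HB Require Import structures.
From mathcomp Require Import all_boot all_order all_algebra complex ring.
From mathcomp Require Import boolp classical_sets functions reals.
From mathcomp Require Import topology normedtype.
Set Implicit Arguments.
Unset Strict Implicit.
Unset Printing Implicit Defensive.
Import Order.TTheory GRing.Theory Num.Theory numFieldNormedType.Exports.
Local Open Scope ring_scope.
Local Open Scope complex_scope.
Local Open Scope classical_set_scope.

(** The heart of the matter is ring theory. Let A be a prime ring without
    2-torsion, e + f = 1 a decomposition into nonzero orthogonal idempotents,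
    and suppose that the centres of eAe and fAf are Z(A)e and Z(A)f. Let phi be
    additive and satisfy condition (T_l).

    If ab = ba = 0, then (T_l) says that every iterated commutator of length
    n - 2 starting at [phi a, b] vanishes, and in a prime ring this forces
    [phi a, b] to be central ([foldl_brackets_central]). Feeding in pairs of
    Peirce components pins down phi on each of them: phi maps eAf into itself
    ([phi_peirce_off]), and for a in eAe it maps a to some w(a) in eAe plus a
    central element ([phi_peirce_diag]). Zero products whose commutator lies in
    an off-diagonal component link these values: phi(xa) = x w(a) for x in fAe
    ([phi_mul_diag]), while the idempotent e + y yields phi(y) = w(e) y for y in
    eAf ([phi_off]). Evaluating phi(ay) in two ways shows that w(e) commutes
    with eAe, hence w(e) = le with l central; by primeness w(a) = la everywhere,
    so that phi(a) - la is central for all a ([Tl_central_form]).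

    Condition (T_r) for A is condition (T_l) for the converse ring, and all
    hypotheses on A are left-right symmetric ([Tr_central_form]).

    A standard operator algebra fits this frame because the Hahn-Banach theorem
    supplies enough rank one operators: they make it prime, they show that any
    operator of eAe commuting with eAe is a scalar multiple of e (for e = 1: the
    centre is the scalars), and one of them is a nontrivial idempotent. Then
    phi(a) = lambda a + mu(a) 1, and for such a map (T_l), or (T_r), evaluated
    at ab = 0 reads mu(p_n(a, b, ...)) = 0, since brackets do not see the central
    summand.

    Hahn-Banach is obtained from minimal sublinear functionals: by Zorn's lemma
    there is one below any given sublinear functional, and minimality forces it
    to be additive. *)

(** * Iterated commutators and Peirce components in prime rings *)

Definition central (A : pzRingType) (c : A) : Prop := forall a, GRing.comm c a.

Definition prime_ring (A : pzRingType) : Prop :=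
  forall a b : A, (forall x, a * x * b = 0) -> a = 0 \/ b = 0.

(** For idempotents e and f this is membership in the Peirce component eAf. *)
Definition peirce (A : pzRingType) (e f x : A) : Prop :=
  e * x = x /\ x * f = x.

(** The centre of the corner ring eAe is as small as possible: Z(eAe) = Z(A)e. *)
Definition corner_center (A : pzRingType) (e : A) : Prop :=
  forall d, peirce e e d -> (forall a, peirce e e a -> GRing.comm d a) ->
  exists2 c, central c & d = c * e.

Definition compl_idem (A : pzRingType) (e f : A) : Prop :=
  [/\ e + f = 1, e * f = 0 & f * e = 0].

Section Brackets.
Variable A : pzRingType.
Implicit Types a b c w x : A.

Lemma centralP w : (forall a, lie_bracket w a = 0) -> central w.
Proof. by move=> h a; apply/eqP; rewrite -subr_eq0; apply/eqP/h. Qed.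

Lemma central_bracket0 c a : central c -> lie_bracket c a = 0.
Proof. by move=> h; rewrite /lie_bracket h subrr. Qed.

Lemma lie_bracketDl a b x :
  lie_bracket (a + b) x = lie_bracket a x + lie_bracket b x.
Proof. by rewrite /lie_bracket mulrDl mulrDr opprD addrACA. Qed.

Hypothesis primeA : prime_ring A.

Lemma central_mul_eq0 c a : central c -> c * a = 0 -> c = 0 \/ a = 0.
Proof. by move=> Zc ca0; apply: primeA => x; rewrite (Zc x) -mulrA ca0 mulr0. Qed.

(** The bracket with w is a derivation that kills w, so [w, aw] = [w, a]w is
    central along with [w, a]; comparing [w, a]wa with a[w, a]w gives
    [w, a]^2 = 0, and a central element of square zero vanishes. *)
Lemma central_brackets_central w :
  (forall a, central (lie_bracket w a)) -> central w.
Proof.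
move=> h; apply: centralP => a.
set c := lie_bracket w a.
suff c2 : c * c = 0 by case: (central_mul_eq0 (h a) c2).
have E b : lie_bracket w (b * w) = lie_bracket w b * w.
  by rewrite /lie_bracket mulrBl !mulrA.
have := h (a * w) a; rewrite E -/c /GRing.comm => H.
by rewrite {2}/c /lie_bracket mulrBr !mulrA H mulrA (h a a) subrr.
Qed.

(** By induction on the length: the hypothesis for length m + 1 at w is the one for
    length m at every [w, a], so that all the brackets [w, a] are central. *)
Lemma foldl_brackets_central m w :
  (forall s : m.-tuple A, foldl (@lie_bracket _) w s = 0) -> central w.
Proof.
elim: m w => [|m IH] w h.
  rewrite -[w]/(foldl (@lie_bracket _) w [tuple]) h => a.
  by rewrite /GRing.comm mul0r mulr0.
apply: central_brackets_central => a; apply: IH => s.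
exact: (h [tuple of a :: s]).
Qed.

End Brackets.

Section Peirce.
Variables (A : pzRingType) (e f : A).
Hypothesis ef : compl_idem e f.

Lemma compl_idem_sym : compl_idem f e.
Proof. by case: ef => h1 h2 h3; split; rewrite // addrC. Qed.

Lemma compl_idem_idem : e * e = e.
Proof.
by case: ef => h1 h2 h3; rewrite -{3}[e]mulr1 -h1 mulrDr h2 addr0.
Qed.

Lemma peirce_right0 (a x : A) : peirce a e x -> x * f = 0.
Proof. by case: ef => _ h _ [_ <-]; rewrite -mulrA h mulr0. Qed.

Lemma peirce_left0 (b x : A) : peirce e b x -> f * x = 0.
Proof. by case: ef => _ _ h [<- _]; rewrite mulrA h mul0r. Qed.

Lemma peirceM (a b c x y : A) : peirce a b x -> peirce b c y -> peirce a c (x * y).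
Proof. by move=> [h1 h2] [h3 h4]; split; rewrite ?mulrA ?h1 // -mulrA h4. Qed.

Lemma peirce_decomp (x : A) :
  x = e * x * e + e * x * f + (f * x * e + f * x * f).
Proof.
by case: ef => h _ _; rewrite -!mulrDr h !mulr1 -mulrDl h mul1r.
Qed.

(** On fAe the operator [-, e] is the identity, so that padding with copies of e
    produces arguments a_3, ..., a_n that do not disturb a commutator in fAe. *)
Lemma foldl_peirce m (x : A) : peirce f e x ->
  foldl (@lie_bracket _) x (nseq m e) = x.
Proof.
move=> h; elim: m => //= m IH.
case: ef => _ h1 _; case: h => h2 h3.
by rewrite {2}/lie_bracket -{2}h2 mulrA h1 mul0r subr0 h3.
Qed.
End Peirce.

(** * Additive maps satisfying the left condition *)

Section LeftCondition.
Variables (A : pzRingType) (n : nat) (phi : A -> A).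
Hypotheses (primeA : prime_ring A) (tfA : forall a : A, a + a = 0 -> a = 0).
Hypothesis phiD : {morph phi : x y / x + y}.
Hypothesis Tl : cond_Tl n phi.

Lemma phi0 : phi 0 = 0.
Proof. by apply: (addrI (phi 0)); rewrite -phiD !addr0. Qed.

Lemma phiN x : phi (- x) = - phi x.
Proof. by apply: (addrI (phi x)); rewrite -phiD !subrr phi0. Qed.

Lemma Tl_foldl_nseq a b e : a * b = 0 ->
  phi (foldl (@lie_bracket _) (lie_bracket a b) (nseq (n - 2) e)) =
  foldl (@lie_bracket _) (lie_bracket (phi a) b) (nseq (n - 2) e).
Proof. by move=> ab0; apply: (Tl [tuple of nseq (n - 2) e] ab0). Qed.

(** Here p_n(a, b, ...) is zero for every choice of the remaining arguments, so all
    iterated commutators of [phi a, b] vanish. *)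
Lemma Tl_bracket_central a b : a * b = 0 -> b * a = 0 ->
  central (lie_bracket (phi a) b).
Proof.
move=> ab0 ba0; apply: (@foldl_brackets_central _ primeA (n - 2)) => s.
rewrite -[LHS](Tl s ab0) /=.
have -> : lie_bracket a b = 0 by rewrite /lie_bracket ab0 ba0 subrr.
suff -> : foldl (@lie_bracket A) 0 s = 0 by rewrite phi0.
elim: {+}(tval s) => //= b' l IH.
by have -> : lie_bracket 0 b' = 0 by rewrite /lie_bracket mul0r mulr0 subrr.
Qed.

Section OneIdempotent.
Variables (e f : A).
Hypothesis ef : compl_idem e f.

(** A bracket with f has no diagonal part; the hypothesis on w covers k = 0. *)
Lemma off_diagonal_bracket k w : e * w * e = 0 -> f * w * f = 0 ->
  let v := foldl (@lie_bracket A) w (nseq k f) in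
  e * v * e = 0 /\ f * v * f = 0.
Proof.
have [_ ef0 fe0] := ef; have ff := compl_idem_idem (compl_idem_sym ef).
elim: k w => //= k IH w h1 h2; apply: IH; rewrite /lie_bracket mulrBr mulrBl.
  by rewrite !mulrA ef0 !mul0r subr0 -!mulrA fe0 !mulr0.
by rewrite !mulrA ff -!mulrA ff subrr.
Qed.

(** The pair (y, e) with arguments f, ..., f expresses phi(y) as a commutator
    without diagonal part, so phi(y) = (eAf part) + u with u in fAe. To kill u,
    pair y with z in eAf: c = uz - zu is central, and cz = -zuz while zc = zuz.
    Without 2-torsion zuz = 0, hence cz = 0 and c = 0, so uz = 0 for all z. *)
Lemma phi_peirce_off y : peirce e f y -> peirce e f (phi y).
Proof.
move=> yP; have [ef1 ef0 fe0] := ef; have fe := compl_idem_sym ef.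
have [ee ff] := (compl_idem_idem ef, compl_idem_idem fe).
have ye0 : y * e = 0 by apply: peirce_right0 fe _ _ yP.
have fy0 : f * y = 0 by apply: peirce_left0 ef _ _ yP.
have [ey yf] := yP.
have [ve vf] : e * phi y * e = 0 /\ f * phi y * f = 0.
  have := Tl_foldl_nseq f ye0.
  have -> : lie_bracket y e = - y by rewrite /lie_bracket ye0 sub0r ey.
  have Ny : peirce e f (- y) by split; rewrite ?mulrN ?mulNr ?ey ?yf.
  rewrite (foldl_peirce fe _ Ny) phiN => E.
  have [|| h1 h2] := @off_diagonal_bracket (n - 2) (lie_bracket (phi y) e).
  - by rewrite /lie_bracket mulrBr mulrBl !mulrA ee -!mulrA ee subrr.
  - rewrite /lie_bracket mulrBr mulrBl !mulrA fe0 !mul0r subr0.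
    by rewrite -!mulrA ef0 !mulr0.
  move: h1 h2; rewrite -E !mulrN !mulNr => h1 h2.
  by split; rewrite -[LHS]opprK (h1, h2) oppr0.
set v := phi y in ve vf *; set u := f * v * e.
have vE : v = e * v * f + u.
  by rewrite {1}(peirce_decomp ef v) ve vf add0r addr0.
have uP : peirce f e u by rewrite /peirce /u !mulrA ff -!mulrA ee.
have [fu ue] := uP.
suff uz0 z : peirce e f z -> u * z = 0.
  suff u0 : u = 0 by rewrite vE u0 addr0 /peirce !mulrA ee -!mulrA ff.
  have [x|//|f0] := @primeA u f; last by rewrite -fu f0 mul0r.
  have := uz0 (e * x * f); rewrite !mulrA ue; apply.
  by rewrite /peirce !mulrA ee -!mulrA ff.
move=> zP; have [ez zf] := zP; clearbody u.
have zz : z * z = 0 by rewrite -{2}ez mulrA (peirce_right0 fe zP) mul0r.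
have yz : y * z = 0 by rewrite -ez mulrA ye0 mul0r.
have zy : z * y = 0 by rewrite -ey mulrA (peirce_right0 fe zP) mul0r.
have Zc := Tl_bracket_central yz zy; set c := lie_bracket _ _ in Zc.
have cE : c = u * z - z * u.
  have h1 : e * v * f * z = 0 by rewrite -mulrA (peirce_left0 ef zP) mulr0.
  have h2 : z * (e * v * f) = 0 by rewrite !mulrA (peirce_right0 fe zP) !mul0r.
  by rewrite /c /lie_bracket -/v vE mulrDl mulrDr h1 h2 !add0r.
have zc : z * c = z * u * z.
  by rewrite cE mulrBr !mulrA zz mul0r subr0.
have cz : c * z = - (z * u * z) by rewrite cE mulrBl -mulrA zz mulr0 sub0r.
have zuz : z * u * z = 0 by apply: tfA; rewrite -{1}zc -(Zc z) cz addNr.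
have cz0 : c * z = 0 by rewrite cz zuz oppr0.
have [c0|z0] := central_mul_eq0 primeA Zc cz0; last by rewrite z0 mulr0.
have uzzu : u * z = z * u by apply/eqP; rewrite -subr_eq0 -cE c0.
by rewrite -fu -mulrA uzzu mulrA (peirce_left0 ef zP) mul0r.
Qed.

Hypotheses (e0 : e <> 0) (Cf : corner_center f).

(** An a in eAe annihilates fAf on both sides, so [phi(a), b] is central for b in
    fAf. For b = f this removes the off-diagonal part of phi(a); for general b the
    commutator is a central element killed by e, hence zero, so f phi(a) f lies in
    the centre of fAf and equals cf with c central. Subtract c. *)
Lemma phi_peirce_diag a : peirce e e a ->
  exists2 w, peirce e e w & central (phi a - w).
Proof.
move=> aP; have [ef1 ef0 fe0] := ef; have fe := compl_idem_sym ef.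
have [ee ff] := (compl_idem_idem ef, compl_idem_idem fe).
have [ea ae] := aP; have fa0 := peirce_left0 ef aP.
have af0 : a * f = 0 by apply: peirce_right0 ef _ _ aP.
set v := phi a.
have Zv b : peirce f f b -> central (lie_bracket v b).
  by move=> bP; apply: Tl_bracket_central; rewrite -?(peirce_right0 ef bP);
     [rewrite -ae -bP.1 -mulrA (mulrA e) ef0 mul0r mulr0
     |rewrite -ea -bP.2 -mulrA (mulrA f) fe0 mul0r mulr0].
have fP : peirce f f f by split.
have Zvf := Zv f fP.
have evf : e * v * f = 0.
  have : e * lie_bracket v f * f = 0 by rewrite -(Zvf e) -mulrA ef0 mulr0.
  by rewrite /lie_bracket mulrBr mulrBl !mulrA ef0 !mul0r subr0 -!mulrA ff mulrA.
have fve : f * v * e = 0.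
  have : f * lie_bracket v f * e = 0 by rewrite -(Zvf f) -mulrA fe0 mulr0.
  rewrite /lie_bracket mulrBr mulrBl !mulrA ff -!mulrA fe0 !mulr0 sub0r mulrA.
  by move/eqP; rewrite oppr_eq0 => /eqP.
have comm_v b : peirce f f b -> v * b = b * v.
  move=> bP; have Zc := Zv b bP.
  have eb0 := peirce_left0 fe bP.
  have ce0 : lie_bracket v b * e = 0.
    rewrite (Zc e) /lie_bracket mulrBr !mulrA eb0 mul0r subr0.
    by rewrite -bP.1 !mulrA evf mul0r.
  have [c0|//] := central_mul_eq0 primeA Zc ce0.
  by apply/eqP; rewrite -subr_eq0 -/(lie_bracket v b) c0.
have [|b bP|c Zc dE] := Cf (d := f * v * f).
- by split; rewrite ?mulrA ?ff // -!mulrA ff.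
- have [fb bf] := bP.
  rewrite /GRing.comm -mulrA fb -mulrA comm_v // mulrA fb.
  by rewrite !mulrA bf -comm_v // -mulrA bf.
have vE : v = e * v * e + c * f.
  by rewrite {1}(peirce_decomp ef v) evf fve addr0 add0r dE.
exists (e * v * e - c * e).
  split; first by rewrite mulrBr !mulrA ee -(Zc e) -[c * e * e]mulrA ee.
  by rewrite mulrBl -!mulrA ee.
suff -> : v - (e * v * e - c * e) = c by [].
rewrite {1}vE opprB addrC addrA subrK.
by rewrite -mulrDr ef1 mulr1.
Qed.

(** The zero product ax = 0 has [a, x] = -xa in fAe, and [phi(a), x] = -xw; both
    are fixed by the padding with copies of e. *)
Lemma phi_mul_diag a w x : peirce e e a -> central (phi a - w) ->
  peirce e e w -> peirce f e x -> phi (x * a) = x * w.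
Proof.
move=> aP Zaw wP xP; have [_ ef0 _] := ef; have fe := compl_idem_sym ef.
have mul0 b : peirce e e b -> b * x = 0.
  by move=> bP; rewrite -bP.2 -mulrA (peirce_left0 fe xP) mulr0.
have xP' b : peirce e e b -> peirce f e (- (x * b)).
  move=> bP; have [h1 h2] := peirceM xP bP.
  by split; rewrite ?mulrN ?mulNr ?h1 ?h2.
have := Tl_foldl_nseq e (mul0 a aP).
have -> : lie_bracket a x = - (x * a) by rewrite /lie_bracket mul0 // sub0r.
have -> : lie_bracket (phi a) x = - (x * w).
  rewrite -[phi a](subrK w) lie_bracketDl central_bracket0 // add0r.
  by rewrite /lie_bracket mul0 // sub0r.
rewrite !(foldl_peirce ef) ?xP' //; last 2 first.
- exact: xP'.
- exact: xP'.
by rewrite phiN => /oppr_inj.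
Qed.

(** The idempotent e + y is orthogonal to its complement f - y, so
    [phi(e + y), f - y] is central; it works out to phi(y) - wy, an element of
    eAf, and a central element of eAf is zero. *)
Lemma phi_off w y : peirce e e w -> central (phi e - w) -> peirce e f y ->
  phi y = w * y.
Proof.
move=> wP Zew yP; have [ef1 ef0 fe0] := ef; have fe := compl_idem_sym ef.
have [ee ff] := (compl_idem_idem ef, compl_idem_idem fe).
have ye0 : y * e = 0 by apply: peirce_right0 fe _ _ yP.
have fy0 : f * y = 0 by apply: peirce_left0 ef _ _ yP.
have [ey yf] := yP.
have yy : y * y = 0 by rewrite -{2}ey mulrA ye0 mul0r.
have [ev vf] := phi_peirce_off yP; set v := phi y in ev vf *.
have vy : v * y = 0 by rewrite -vf -mulrA fy0 mulr0.
have wf : w * f = 0 by rewrite -wP.2 -mulrA ef0 mulr0.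
have fw : f * w = 0 by rewrite -wP.1 mulrA fe0 mul0r.
have yw : y * w = 0 by rewrite -wP.1 mulrA ye0 mul0r.
have fv : f * v = 0 by rewrite -ev mulrA fe0 mul0r.
have yv : y * v = 0 by rewrite -ev mulrA ye0 mul0r.
have Z1 : central (lie_bracket (phi (e + y)) (f - y)).
  apply: Tl_bracket_central.
    by rewrite mulrDl !mulrBr ef0 ey yf yy sub0r subr0 addNr.
  by rewrite mulrDr !mulrBl fe0 ye0 fy0 yy !subr0 addr0.
set c := lie_bracket _ _ in Z1.
have cE : c = v - w * y.
  rewrite /c phiD -[phi e](subrK w) -addrA lie_bracketDl central_bracket0 //.
  rewrite add0r.
  rewrite /lie_bracket -/v mulrDl !mulrBr wf vf vy mulrDr !mulrBl fw yw fv yv.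
  by rewrite !subr0 addr0 sub0r subr0 addrC.
have ec : e * c = c by rewrite cE mulrBr ev mulrA wP.1.
have ce : c * e = 0.
  by rewrite cE mulrBl -{1}vf -!mulrA fe0 ye0 !mulr0 subrr.
apply/eqP; rewrite -subr_eq0 -cE -ec -(Z1 e) ce; exact/eqP.
Qed.

(** If phi(a) is w up to a central element, then lxa = phi(xa) = xw for all x in
    fAe, and primeness cancels x. *)
Lemma phi_diag_scalar l a : f <> 0 -> central l ->
  (forall x, peirce f e x -> phi x = l * x) ->
  peirce e e a -> central (phi a - l * a).
Proof.
move=> f0 Zl phil aP; have fe := compl_idem_sym ef.
have [ee ff] := (compl_idem_idem ef, compl_idem_idem fe).
have [w wP Zw] := phi_peirce_diag aP.
suff <- : w = l * a by [].
apply/eqP; rewrite -subr_eq0; apply/eqP.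
have [x|//|//] := @primeA f (w - l * a).
rewrite -[w]wP.1 -[a]aP.1 mulrA (Zl e) -[e * l * a]mulrA -mulrBr [LHS]mulrA.
set x' := f * x * e.
have xP : peirce f e x' by rewrite /x' /peirce !mulrA ff -!mulrA ee.
apply/eqP; rewrite mulrBr subr_eq0 -(phi_mul_diag aP Zw wP xP).
by rewrite (phil _ (peirceM xP aP)) mulrA (Zl x') -mulrA.
Qed.

End OneIdempotent.

Theorem Tl_central_form (e f : A) : compl_idem e f -> e <> 0 -> f <> 0 ->
  corner_center e -> corner_center f ->
  exists2 l, central l & forall a, central (phi a - l * a).
Proof.
move=> ef e0 f0 Ce Cf; have fe := compl_idem_sym ef.
have [ee ff] := (compl_idem_idem ef, compl_idem_idem fe).
have eP : peirce e e e by split.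
have fP : peirce f f f by split.
have [w wP Zw] := phi_peirce_diag ef e0 Cf eP.
have [w' wP' Zw'] := phi_peirce_diag fe f0 Ce fP.
have off b : peirce e e b -> (forall y, peirce e f y -> b * y = 0) -> b = 0.
  move=> bP h; have [x||//] := @primeA b f; last by [].
  have := h (e * x * f); rewrite !mulrA bP.2; apply.
  by rewrite /peirce !mulrA ee -!mulrA ff.
(* For y in eAf, phi(ay) is way by [phi_off] and a phi(y) = awy because phi acts on
   eAf also as right multiplication by w'. *)
have wC a : peirce e e a -> GRing.comm w a.
  move=> aP; apply/eqP; rewrite -subr_eq0; apply/eqP/off.
    have [h1 h2] := peirceM wP aP; have [h3 h4] := peirceM aP wP.
    by rewrite /peirce mulrBr mulrBl h1 h2 h3 h4.
  move=> y yP; rewrite mulrBl; apply/eqP; rewrite subr_eq0; apply/eqP.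
  have ayP := peirceM aP yP.
  rewrite -mulrA -(phi_off ef wP Zw ayP) -mulrA -(phi_off ef wP Zw yP).
  rewrite -{1}ayP.2 -[in RHS]yP.2.
  rewrite (phi_mul_diag fe fP Zw' wP' ayP) (phi_mul_diag fe fP Zw' wP' yP).
  by rewrite mulrA.
have [l Zl wE] := Ce w wP wC; exists l => // a.
have phi_ef y : peirce e f y -> phi y = l * y.
  by move=> yP; rewrite (phi_off ef wP Zw yP) wE -mulrA yP.1.
have phi_fe x : peirce f e x -> phi x = l * x.
  move=> xP; rewrite -{1}xP.2 (phi_mul_diag ef eP Zw wP xP) wE mulrA -(Zl x).
  by rewrite -mulrA xP.2.
have -> : phi a - l * a = (phi (e * a * e) - l * (e * a * e)) +
                          (phi (f * a * f) - l * (f * a * f)).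
  have P g g' : g * g = g -> g' * g' = g' -> peirce g g' (g * a * g').
    by move=> h h'; rewrite /peirce !mulrA h -!mulrA h'.
  rewrite {1 2}(peirce_decomp ef a) !phiD.
  rewrite (phi_ef (e * a * f)) ?(phi_fe (f * a * e)); try exact: P.
  rewrite !mulrDr opprD addrACA; congr (_ + _).
    by rewrite opprD addrACA subrr addr0.
  by rewrite opprD addrACA subrr add0r.
have Pd g : g * g = g -> peirce g g (g * a * g).
  by move=> h; rewrite /peirce !mulrA h -!mulrA h.
have Ze := phi_diag_scalar ef e0 Cf f0 Zl phi_fe (Pd e ee).
have Zf := phi_diag_scalar fe f0 Ce e0 Zl phi_ef (Pd f ff).
by move=> b; rewrite /GRing.comm mulrDl mulrDr (Ze b) (Zf b).
Qed.
End LeftCondition.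

(** * The right condition, through the converse ring *)

Section Converse.
Variable A : pzRingType.
Implicit Types a b w e f : A.

Lemma foldl_bracketN w (s : seq A) :
  foldl (@lie_bracket A) (- w) s = - foldl (@lie_bracket A) w s.
Proof.
elim: s w => //= a s IH w; rewrite -IH; congr foldl.
by rewrite /lie_bracket mulNr mulrN -opprD.
Qed.

(** Each bracket of the converse ring is the opposite of the bracket of A. *)
Lemma foldl_bracket_converse w (s : seq A) :
  foldl (@lie_bracket A^c) w s = (-1) ^+ size s * foldl (@lie_bracket A) w s.
Proof.
elim: s w => [|a s IH] w /=; first by rewrite mul1r.
have -> : @lie_bracket A^c w a = - lie_bracket w a by rewrite /lie_bracket opprB.
by rewrite IH foldl_bracketN exprS mulN1r mulNr mulrN.
Qed.

(** A zero product ab in the converse ring is a zero product ba in A, and the first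
    bracket [a, b] of the converse ring is [b, a] in A; the n - 2 further brackets
    contribute the same sign to both sides. *)
Lemma cond_Tr_converse n (phi : A -> A) : {morph phi : x y / x + y} ->
  cond_Tr n phi -> cond_Tl n (phi : A^c -> A^c).
Proof.
move=> phiD Tr a b s ab0.
have sgn k x : phi ((-1) ^+ k * x) = (-1) ^+ k * phi x.
  rewrite -signr_odd; case: (odd k); last by rewrite !mul1r.
  by rewrite !mulN1r (phiN phiD).
rewrite /= !foldl_bracket_converse sgn; congr (_ * _).
exact: (Tr b a s ab0).
Qed.

Lemma central_converse (c : A) : central (c : A^c) <-> central c.
Proof. by split=> h a; symmetry; apply: h. Qed.

Lemma prime_converse : prime_ring A -> prime_ring A^c.
Proof.
move=> pA a b h; have [x|->|->] := pA b a; [|by right|by left].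
by rewrite -mulrA; exact: h.
Qed.

Lemma peirce_converse e f (x : A) : @peirce A^c e f x <-> peirce f e x.
Proof. by split=> -[]. Qed.

Lemma corner_center_converse e : corner_center e -> corner_center (e : A^c).
Proof.
move=> Ce d dP dC; have [|a aP|c Zc dE] := Ce d; first exact/peirce_converse.
  by symmetry; apply: dC; apply/peirce_converse.
by exists c; [exact/central_converse|rewrite dE (Zc e)].
Qed.

Theorem Tr_central_form n (phi : A -> A) e f : prime_ring A ->
  (forall a, a + a = 0 -> a = 0) -> {morph phi : x y / x + y} ->
  cond_Tr n phi ->
  compl_idem e f -> e <> 0 -> f <> 0 -> corner_center e -> corner_center f ->
  exists2 l, central l & forall a, central (phi a - l * a).
Proof.
move=> pA tfA phiD Tr [ef1 ef0 fe0] e0 f0 Ce Cf.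
have [|||l Zl h] := @Tl_central_form A^c n phi (prime_converse pA) tfA phiD
  (cond_Tr_converse phiD Tr) e f _ e0 f0.
- by split.
- exact: corner_center_converse.
- exact: corner_center_converse.
exists l => [|a]; first exact/central_converse.
by rewrite ((central_converse l).1 Zl a); apply/central_converse; exact: h.
Qed.
End Converse.

(** * Bounded functionals on complex normed spaces *)

Section Sublinear.
Variables (R : realType) (V : lmodType R).
Implicit Types (p q : V -> R) (x y : V) (r t : R).

Definition sublinear p : Prop :=
  (forall x y, p (x + y) <= p x + p y) /\
  (forall r x, 0 <= r -> p (r *: x) <= r * p x).

Lemma sublinear_homo p r x : sublinear p -> 0 <= r -> p (r *: x) = r * p x.
Proof.
move=> [pD pZ]; rewrite le_eqVlt => /predU1P[<-|r0]; last first.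
  apply/eqP; rewrite eq_le (pZ _ _ (ltW r0)) /=.
  rewrite -ler_pdivlMl // -{1}[x](scalerK (lt0r_neq0 r0)).
  by rewrite pZ // invr_ge0 ltW.
rewrite scale0r mul0r; apply/eqP; rewrite eq_le.
have := pZ 0 0 (lexx 0); rewrite scale0r mul0r => -> /=.
by have := pD 0 0; rewrite addr0 lerDl.
Qed.

Lemma sublinear0 p : sublinear p -> p 0 = 0.
Proof. by move=> /(@sublinear_homo _ 0 0)-/(_ (lexx 0)); rewrite scale0r mul0r. Qed.

Lemma sublinear_geN p q x : sublinear q -> (forall y, q y <= p y) ->
  - p (- x) <= q x.
Proof.
move=> sq qp; have [qD _] := sq; rewrite lerNl.
apply: le_trans (qp _); rewrite -subr_ge0 opprK -(sublinear0 sq) -(addNr x).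
exact: qD.
Qed.

(** The witness is q(x) = inf over t >= 0 of p(x + t x0) - t p(x0). It is what
    makes a minimal sublinear functional additive: minimality gives q = p, and the
    instance t = 1 reads p(x) + p(x0) <= p(x + x0). *)
Lemma sublinear_shift p x0 : sublinear p ->
  exists q, [/\ sublinear q, forall x, q x <= p x &
    forall t x, 0 <= t -> q x <= p (x + t *: x0) - t * p x0].
Proof.
move=> sp; have [pD pZ] := sp.
pose S x := [set z | exists2 t, 0 <= t & z = p (x + t *: x0) - t * p x0].
have lbS x : lbound (S x) (- p (- x)).
  move=> _ [t t0 ->]; rewrite lerBrDr addrC -(sublinear_homo _ sp t0).
  by rewrite lerBlDr -{1}[t *: x0](addKr x) addrC.
have SP t x : 0 <= t -> inf (S x) <= p (x + t *: x0) - t * p x0.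
  by move=> t0; apply: ge_inf; [exists (- p (- x)); exact: lbS|exists t].
have lS b x : (forall t, 0 <= t -> b <= p (x + t *: x0) - t * p x0) ->
    b <= inf (S x).
  move=> h; apply: lb_le_inf => [|_ [t t0 ->]]; last exact: h.
  by exists (p (x + 0 *: x0) - 0 * p x0), 0.
exists (fun x => inf (S x)); split=> [|x|//]; last first.
  by have := SP 0 x (lexx 0); rewrite scale0r addr0 mul0r subr0.
split=> [x y|r x r0].
  rewrite -lerBlDr; apply: (lS) => t t0; rewrite lerBlDr -lerBlDl.
  apply: (lS) => s s0; rewrite lerBlDl.
  apply: le_trans (SP (t + s) _ (addr_ge0 t0 s0)) _.
  rewrite scalerDl mulrDl opprD addrACA [leRHS]addrACA lerD2r.
  exact: pD.
have [->|rN0] := eqVneq r 0.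
  rewrite scale0r mul0r; apply: le_trans (SP 0 _ (lexx 0)) _.
  by rewrite scale0r addr0 mul0r subr0 (sublinear0 sp).
have rp : 0 < r by rewrite lt_def rN0.
rewrite -ler_pdivrMl //; apply: (lS) => t t0; rewrite ler_pdivrMl //.
apply: le_trans (SP (r * t) _ (mulr_ge0 r0 t0)) _.
by rewrite -scalerA -scalerDr (sublinear_homo _ sp r0) mulrBr mulrA.
Qed.

(** Zorn's lemma: the pointwise infimum of a chain of sublinear functionals below p
    is finite, because they are all bounded below by - p (- x), and sublinear,
    because two members of a chain can be replaced by the smaller one. *)
Lemma minimal_sublinear_exists p : sublinear p ->
  exists q, [/\ sublinear q, forall x, q x <= p x &
    forall q', sublinear q' -> (forall x, q' x <= q x) -> q' = q].
Proof.
move=> sp.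
pose T := {q : V -> R | sublinear q /\ forall x, q x <= p x}.
pose le_T (q1 q2 : T) := `[< forall x, sval q2 x <= sval q1 x >].
have [||||[q [sq qp]] qmin] := @Zorn T le_T.
- by move=> q; apply/asboolP.
- move=> q r s /asboolP h1 /asboolP h2; apply/asboolP => x.
  exact: le_trans (h2 _) (h1 _).
- move=> [q hq] [r hr] /asboolP h1 /asboolP h2; apply: eq_exist => /=.
  by apply/funext => x; apply/eqP; rewrite eq_le h1 h2.
- move=> C totC; have [[q0 Cq0]|C0] := pselect (exists q : T, C q); last first.
    have pp : sublinear p /\ forall x, p x <= p x by [].
    by exists (exist _ p pp : T) => s Cs; case: C0; exists s.
  pose S x := [set z | exists2 q : T, C q & z = sval q x].
  have lbS x : lbound (S x) (- p (- x)).
    by move=> _ [[q [sq qp]] _ ->]; apply: sublinear_geN.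
  have SP (q : T) x : C q -> inf (S x) <= sval q x.
    by move=> Cq; apply: ge_inf; [exists (- p (- x)); exact: lbS|exists q].
  have lS b x : (forall q : T, C q -> b <= sval q x) -> b <= inf (S x).
    move=> h; apply: lb_le_inf => [|_ [q Cq ->]]; last exact: h.
    by exists (sval q0 x), q0.
  have si : sublinear (fun x => inf (S x)) /\ forall x, inf (S x) <= p x.
    split; last by move=> x; apply: le_trans (SP _ _ Cq0) _; case: (svalP q0).
    split=> [x y|r x r0].
      rewrite -lerBlDr; apply: (lS) => q Cq; rewrite lerBlDr -lerBlDl.
      apply: (lS) => r Cr; rewrite lerBlDl.
      have [[qD _] _] := svalP q; have [[rD _] _] := svalP r.
      have [/asboolP h|/asboolP h] := totC _ _ Cq Cr.
        apply: le_trans (SP _ _ Cr) _; apply: le_trans (rD _ _) _.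
        by rewrite lerD2r.
      apply: le_trans (SP _ _ Cq) _; apply: le_trans (qD _ _) _.
      by rewrite lerD2l.
    have [r00|rN0] := eqVneq r 0.
      apply: le_trans (SP _ _ Cq0) _; have [[_ +] _] := svalP q0.
      by move=> /(_ r x r0); rewrite r00 !mul0r.
    have rp : 0 < r by rewrite lt_def rN0.
    rewrite -ler_pdivrMl //; apply: (lS) => q Cq; rewrite ler_pdivrMl //.
    apply: le_trans (SP _ _ Cq) _; have [[_ +] _] := svalP q; exact.
  exists (exist _ (fun x => inf (S x)) si : T) => q Cq.
  by apply/asboolP => x; exact: SP.
exists q; split=> // q' sq' q'q.
have q'p : sublinear q' /\ forall x, q' x <= p x.
  by split=> // x; exact: le_trans (q'q x) (qp x).
apply: (congr1 sval (qmin (exist _ q' q'p : T) _)).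
exact/asboolP.
Qed.

(** A minimal sublinear functional below the shift of p at x0 is linear, and takes
    at - x0 a value at most p 0 - p x0 = - p x0, hence the value p x0 at x0. *)
Theorem linear_minorant p x0 : sublinear p ->
  exists u : V -> R, [/\ scalar u, forall x, u x <= p x & u x0 = p x0].
Proof.
move=> sp; have [p1 [sp1 p1p shift1]] := sublinear_shift x0 sp.
have [u [su up umin]] := minimal_sublinear_exists sp1.
have up' x : u x <= p x by exact: le_trans (up x) (p1p x).
have uD x y : u (x + y) = u x + u y.
  apply/eqP; rewrite eq_le; have [-> _] := su.
  have [q [sq qu shift]] := sublinear_shift y su.
  have := shift 1 x ler01; rewrite (umin q sq qu) scale1r mul1r.
  by rewrite lerBrDr.
have uN x : u (- x) = - u x.
  by apply/eqP; rewrite -addr_eq0 -uD addNr (sublinear0 su).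
have uZ r x : u (r *: x) = r * u x.
  have [r0|/ltW r0] := leP 0 r; first exact: sublinear_homo.
  rewrite -[r]opprK scaleNr uN (sublinear_homo _ su) ?mulNr //.
  by rewrite oppr_ge0.
exists u; split=> // [r x y|]; first by rewrite uD uZ.
apply/eqP; rewrite eq_le up' /=.
have := le_trans (up (- x0)) (shift1 1 (- x0) ler01).
by rewrite uN scale1r addNr (sublinear0 sp) mul1r sub0r lerN2.
Qed.
End Sublinear.

(** The real minorant theorem applies to a complex space once its scalars are
    restricted; an alias of the carrier holds that second module structure. *)
Section RealRestriction.
Variables (R : realType) (X : lmodType R[i]).
Definition real_restriction : Type := X.
HB.instance Definition _ := GRing.Zmodule.on real_restriction.
Definition real_scale (r : R) (x : real_restriction) : real_restriction :=
  r%:C *: (x : X).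
Lemma real_scaleA a b v : real_scale a (real_scale b v) = real_scale (a * b) v.
Proof. by rewrite /real_scale scalerA rmorphM. Qed.
Lemma real_scale1 : left_id 1 real_scale.
Proof. by move=> v; rewrite /real_scale rmorph1 scale1r. Qed.
Lemma real_scaleDr : right_distributive real_scale +%R.
Proof. by move=> r x y; rewrite /real_scale scalerDr. Qed.
Lemma real_scaleDl v : {morph real_scale^~ v : a b / a + b}.
Proof. by move=> a b; rewrite /real_scale rmorphD scalerDl. Qed.
HB.instance Definition _ := GRing.Zmodule_isLmodule.Build R real_restriction
  real_scaleA real_scale1 real_scaleDr real_scaleDl.
End RealRestriction.

(** A real-linear u dominated by the norm is the real part of the complex-linear
    functional x |-> u(x) - i u(ix), which is bounded and nonzero at x0 when
    u(x0) = |x0|. *)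
Theorem bounded_functional_separates (R : realType) (X : normedModType R[i])
    (x0 : X) : x0 != 0 ->
  exists h : X -> R[i],
    [/\ scalar h, exists M, forall x, `|h x| <= M * `|x| & h x0 = 1].
Proof.
move=> x0N0.
have normC (x : X) : `|x| = (complex.Re `|x|)%:C.
  by rewrite RRe_real // ger0_real.
pose p (x : real_restriction X) : R := complex.Re `|x : X|.
have sp : sublinear p.
  split=> [x y|r x r0].
    by rewrite -lecR rmorphD /= -!normC ler_normD.
  have -> : p (r *: x) = complex.Re (r%:C * `|x : X|).
    rewrite /p -[r *: x]/(r%:C *: (x : X)) normrZ ger0_norm //.
    by rewrite ler0c.
  by rewrite [`|_|]normC -rmorphM /=.
have [u [ulin up ux0]] := linear_minorant (x0 : real_restriction X) sp.
have uD (x y : X) : u (x + y) = u x + u y.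
  by have := ulin 1 x y; rewrite scale1r mul1r.
have uZ (r : R) (x : X) : u (r%:C *: x) = r * u x.
  have u0 : u (0 : X) = 0 by apply: (addrI (u (0 : X))); rewrite -uD !addr0.
  by have := ulin r x (0 : X); rewrite u0 !addr0.
have uN (x : X) : u (- x) = - u x.
  by have := uZ (- 1) x; rewrite rmorphN1 scaleN1r mulN1r.
pose h (x : X) : R[i] := (u x)%:C - 'i * (u ('i *: x))%:C.
have hlin : scalar h.
  move=> [a b] x y.
  have kE : (a +i* b) = a%:C + b%:C * 'i by simpc.
  have ii : 'i * 'i = -1 :> R[i] by simpc.
  have E1 : u ((a +i* b) *: x + y) = a * u x + b * u ('i *: x) + u y.
    by rewrite kE scalerDl -scalerA !uD !uZ.
  have E2 : u ('i *: ((a +i* b) *: x + y)) =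
      a * u ('i *: x) - b * u x + u ('i *: y).
    rewrite kE scalerDr scalerA mulrDr mulrCA ii mulrN1 (mulrC 'i).
    by rewrite scalerDl scaleNr -scalerA !uD uN !uZ.
  rewrite /h E1 E2; apply/eqP; rewrite eq_complex /=; simpc.
  by rewrite andTb; apply/eqP; ring.
have hb x : `|h x| <= 2 * `|x|.
  have ub (y : X) : `|(u y)%:C| <= `|y|.
    rewrite [leRHS]normC normc_def /= expr0n addr0 sqrtr_sqr lecR.
    rewrite ler_norml up andbT lerNl -uN.
    by apply: le_trans (up _) _; rewrite /p normrN.
  have i1 : `|'i : R[i]| = 1 by rewrite complexiE normCi.
  rewrite mulr2n mulrDl mul1r; apply: le_trans (ler_normB _ _) _.
  apply: lerD; first exact: ub.
  rewrite normrM i1 mul1r; apply: le_trans (ub _) _.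
  by rewrite normrZ i1 mul1r.
have hx0 : h x0 != 0.
  apply: contra_neq x0N0 => /eqP; rewrite eq_complex /=; simpc => /andP[/eqP hx _].
  apply/eqP; rewrite -normr_eq0 normC -/(p x0) -ux0 hx; exact/eqP.
exists (fun x => (h x0)^-1 * h x); split.
- by move=> k x y; rewrite hlin mulrDr mulrCA.
- exists (`|(h x0)^-1| * 2) => x; rewrite normrM -mulrA.
  exact: ler_wpM2l.
- by rewrite mulVf.
Qed.

(** * Standard operator algebras *)

Section StandardOperatorAlgebra.
Variables (R : realType) (X : normedModType R[i]) (U : set (bop X)).
Variables (stdU : standard_operator_algebra U) (U1 : U 1).
Notation A := (soa stdU U1).
Implicit Types (S T : A) (x y z : X) (k : R[i]).

Lemma soa_ext S T : (forall x, S x = T x) -> S = T.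
Proof. by move=> ST; apply/val_inj/bop_ext. Qed.

Lemma soa_linear T k x y : T (k *: x + y) = k *: T x + T y.
Proof. by have [lT _] := bopP T; exact: lT. Qed.

Lemma soaD T x y : T (x + y) = T x + T y.
Proof. by have := soa_linear T 1 x y; rewrite !scale1r. Qed.

Lemma soa0 T : T 0 = 0.
Proof. by apply: (addrI (T 0)); rewrite -soaD !addr0. Qed.

Lemma soaZ T k x : T (k *: x) = k *: T x.
Proof. by have := soa_linear T k x 0; rewrite !addr0 soa0 addr0. Qed.

Lemma soa_mulZr S k T : S * (k *: T) = k *: (S * T).
Proof. by apply: soa_ext => x; exact: soaZ. Qed.

Lemma soa_mulZl S k T : (k *: S) * T = k *: (S * T).
Proof. by apply: soa_ext. Qed.

Lemma rank_one_operator x : x != 0 ->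
  exists h : X -> R[i], [/\ scalar h, h x = 1 &
    forall z, exists T, forall y, T y = h y *: z].
Proof.
move=> /bounded_functional_separates[h [hlin [M hM] hx]]; exists h; split=> // z.
have bT : (fun y => h y *: z) \in @bounded_linear_pred _ X.
  apply/asboolP; split=> [k y y'|]; first by rewrite hlin scalerDl scalerA.
  exists (M * `|z|) => y; rewrite normrZ mulrAC.
  by apply: ler_wpM2r.
have UT : Bop bT \in soa_pred stdU U1.
  apply/asboolP; apply: stdU.2; exists 1, (fun=> z) => y.
  by exists (fun=> h y); rewrite big_ord1.
by exists (Soa UT).
Qed.

Lemma soa_neq0 T : T <> 0 -> exists x, T x != 0.
Proof.
move=> T0; apply: contrapT => h; apply: T0; apply: soa_ext => x.
by apply/eqP/negP => /negP Tx; apply: h; exists x.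
Qed.

(** Choose z with Tz nonzero: some rank one V sends Tz to any prescribed x, and
    then Sx = SVTz = 0. *)
Lemma soa_prime : prime_ring A.
Proof.
move=> S T ST0; have [->|T0] := pselect (T = 0); [by right|left].
have [z /rank_one_operator[h [_ hTz hT]]] := soa_neq0 T0.
apply: soa_ext => x; have [V VE] := hT x.
by have := congr1 (fun W : A => W z) (ST0 V); rewrite /= VE hTz scale1r.
Qed.

Lemma soa_add_self_eq0 T : T + T = 0 -> T = 0.
Proof.
move=> TT; apply: soa_ext => x.
have : T x + T x = 0 by have := congr1 (fun W : A => W x) TT.
by rewrite -mulr2n -scaler_nat => /eqP; rewrite scaler_eq0 pnatr_eq0 => /eqP.
Qed.

(** Take x with ex nonzero and a functional h with h(ex) = 1. Commuting d with the
    compression to eAe of z |-> h(z) y and evaluating at x gives dy = h(dx) ey. *)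
Lemma corner_commutant_scalar (e d : A) : e * e = e -> peirce e e d ->
  (forall a, peirce e e a -> GRing.comm d a) -> exists k, d = k *: e.
Proof.
move=> ee [ed de] dC; have [e0|e0] := pselect (e = 0).
  by exists 0; rewrite scale0r -ed e0 mul0r.
have [x /rank_one_operator[h [_ hx hT]]] := soa_neq0 e0.
exists (h (d x)); apply: soa_ext => y; have [T TE] := hT y.
have aP : peirce e e (e * T * e) by rewrite /peirce !mulrA ee -!mulrA ee.
have := congr1 (fun W : A => W x) (dC _ aP).
have -> : d * (e * T * e) = d * T * e by rewrite !mulrA de.
have -> : e * T * e * d = e * T * d by rewrite -mulrA ed.
by rewrite -[LHS]/(d (T (e x))) -[RHS]/(e (T (d x))) !TE hx scale1r soaZ.
Qed.

Lemma scalar_central k : central (k *: (1 : A)).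
Proof. by move=> a; rewrite /GRing.comm soa_mulZl soa_mulZr mul1r mulr1. Qed.

Lemma soa_corner_center (e : A) : e * e = e -> corner_center e.
Proof.
move=> ee d dP dC; have [k ->] := corner_commutant_scalar ee dP dC.
by exists (k *: (1 : A)); [exact: scalar_central|rewrite soa_mulZl mul1r].
Qed.

Lemma soa_central_scalar (c : A) : central c -> exists k, c = k *: (1 : A).
Proof.
move=> Zc; apply: corner_commutant_scalar; rewrite ?mulr1 //.
by split; rewrite ?mul1r ?mulr1.
Qed.

Lemma dim_ge_neq0 d (b : 'I_d -> X) i :
  (forall c : 'I_d -> R[i], \sum_(j < d) c j *: b j = 0 -> forall j, c j = 0) ->
  b i != 0.
Proof.
move=> bfree; apply/eqP => bi0.
have /bfree/(_ i) : \sum_j (j == i)%:R *: b j = 0 :> X.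
  by apply: big1 => j _; case: eqP => [->|_]; rewrite ?bi0 ?scaler0 ?scale0r.
by rewrite eqxx => /eqP; rewrite oner_eq0.
Qed.

(** The projection y |-> h(y) b_0 on a line, where b_0 and b_1 are independent
    vectors and h(b_0) = 1; it is not the identity, since it maps b_1 into the line
    spanned by b_0. *)
Lemma soa_proper_idempotent : dim_ge X 2 ->
  exists e f : A, [/\ compl_idem e f, e <> 0 & f <> 0].
Proof.
move=> [b bfree].
have b0 := dim_ge_neq0 ord0 bfree.
have [h [_ hb hT]] := rank_one_operator b0.
have [e eE] := hT (b ord0).
have ee : e * e = e.
  by apply: soa_ext => x; rewrite -[LHS]/(e (e x)) (eE x) soaZ eE hb scale1r.
exists e, (1 - e); split.
- split; first by rewrite addrC subrK.
    by rewrite mulrBr mulr1 ee subrr.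
  by rewrite mulrBl mul1r ee subrr.
- move=> e0; have := eE (b ord0); rewrite e0 hb scale1r => /esym/eqP.
  by apply/negP.
- move=> /eqP; rewrite subr_eq0 => /eqP e1.
  pose c (i : 'I_2) : R[i] := if i == ord0 then h (b ord_max) else -1.
  have /bfree/(_ ord_max) : \sum_i c i *: b i = 0.
    rewrite big_ord_recl big_ord1 /c /= scaleN1r -eE -e1.
    by rewrite (_ : lift ord0 ord0 = ord_max) ?subrr //; apply: val_inj.
  by move/eqP; rewrite oppr_eq0 oner_eq0.
Qed.

(** The coefficient mu is the central part evaluated by a functional h at a vector b
    with h(b) = 1, a formula which makes its linearity visible. *)
Lemma scalar_plus_central_form (phi : {linear A -> A}) (l : A) :
  (exists x, x != 0) ->
  central l -> (forall a, central (phi a - l * a)) ->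
  exists (lambda : R[i]) (mu : {linear A -> R[i]^o}),
    forall T, phi T = lambda *: T + mu T *: (1 : A).
Proof.
move=> [b b0] /soa_central_scalar[lambda ->] phiZ.
have [h [hlin hb _]] := rank_one_operator b0.
pose mu T : R[i]^o := h ((phi T - lambda *: T) b).
have mu_linear : linear mu.
  move=> k S T; rewrite /mu linearP scalerDr opprD addrACA.
  by rewrite scalerA mulrC -scalerA -scalerBr -hlin.
pose muL := GRing.isLinear.Build _ _ _ _ mu mu_linear.
pose muT : {linear A -> R[i]^o} := HB.pack mu muL.
exists lambda, muT => T; rewrite -[muT T]/(mu T).
have [k kE] := soa_central_scalar (phiZ T).
rewrite soa_mulZl mul1r in kE; suff -> : mu T = k by rewrite -kE addrC subrK.
rewrite /mu kE -[(k *: (1 : A)) b]/(k *: b).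
by have := hlin (k - 1) b b; rewrite hb mulr1 subrK scalerBl scale1r subrK.
Qed.

Lemma foldl_bracketZ k (w : A) (s : seq A) :
  foldl (@lie_bracket A) (k *: w) s = k *: foldl (@lie_bracket A) w s.
Proof.
elim: s w => //= a s IH w; rewrite -IH; congr foldl.
by rewrite /lie_bracket soa_mulZl soa_mulZr scalerBr.
Qed.

Section ScalarForm.
Variables (phi : A -> A) (lambda : R[i]) (mu : A -> R[i]).
Hypothesis phiE : forall T, phi T = lambda *: T + mu T *: (1 : A).

Lemma lie_p_form_l (a b : A) s :
  lie_p [:: phi a, b & s] = lambda *: lie_p [:: a, b & s].
Proof.
rewrite /= -foldl_bracketZ; congr foldl.
rewrite phiE lie_bracketDl (central_bracket0 _ (scalar_central _)) addr0.
by rewrite /lie_bracket soa_mulZl soa_mulZr scalerBr.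
Qed.

Lemma lie_p_form_r (a b : A) s :
  lie_p [:: a, phi b & s] = lambda *: lie_p [:: a, b & s].
Proof.
rewrite /= -foldl_bracketZ; congr foldl.
rewrite phiE /lie_bracket mulrDl mulrDr !soa_mulZl !soa_mulZr mul1r mulr1.
by rewrite opprD addrACA subrr addr0 scalerBr.
Qed.
End ScalarForm.
End StandardOperatorAlgebra.

Theorem theorem4p2 (R : realType) (X : completeNormedModType R[i])
    (dimX : dim_ge X 2) (U : set (bop X))
    (stdU : standard_operator_algebra U) (U1 : U 1)
    (n : nat) (n_ge2 : (2 <= n)%N)
    (phi : {linear soa stdU U1 -> soa stdU U1}) :
  [<-> cond_T n phi;
       cond_Tl n phi;
       cond_Tr n phi;
       exists (lambda : R[i]) (mu : {linear soa stdU U1 -> R[i]^o}),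
         (forall A, phi A = lambda *: A + mu A *: (1 : soa stdU U1)) /\
         (forall (A1 A2 : soa stdU U1) (s : (n - 2).-tuple (soa stdU U1)),
            A1 * A2 = 0 -> mu (lie_p [:: A1, A2 & s]) = 0)].
Proof.
have [b bfree] := dimX.
have b0 := dim_ge_neq0 ord0 bfree.
have [e [f [ef e0 f0]]] := soa_proper_idempotent stdU U1 dimX.
have Ce := soa_corner_center (compl_idem_idem ef).
have Cf := soa_corner_center (compl_idem_idem (compl_idem_sym ef)).
have phiD : {morph phi : x y / x + y} := raddfD phi.
set form := (exists lambda : R[i], _).
have scalar0 (k : R[i]) : k *: (1 : soa stdU U1) = 0 -> k = 0.
  move=> /(congr1 (fun W : soa stdU U1 => W (b ord0))).
  rewrite -[LHS]/(k *: b ord0) -[RHS]/(0 : X) => /eqP.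
  by rewrite scaler_eq0 (negPf b0) orbF => /eqP.
(* Either condition turns phi (p_n) into lambda *: p_n; comparison with the form of
   phi leaves mu (p_n) = 0. *)
have form_of l : central l -> (forall a, central (phi a - l * a)) ->
    (forall lambda (mu : soa stdU U1 -> R[i]),
      (forall T, phi T = lambda *: T + mu T *: (1 : soa stdU U1)) ->
      forall a1 a2 (s : (n - 2).-tuple (soa stdU U1)), a1 * a2 = 0 ->
      phi (lie_p [:: a1, a2 & s]) = lambda *: lie_p [:: a1, a2 & s]) ->
    form.
  move=> Zl Zphi phi_p.
  have [|lambda [mu phiE]] := scalar_plus_central_form _ Zl Zphi.
    by exists (b ord0).
  exists lambda, mu; split=> // a1 a2 s a12; apply: scalar0.
  apply: (addrI (lambda *: lie_p [:: a1, a2 & s])).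
  by rewrite -phiE (phi_p _ _ phiE) // addr0.
have form_l : cond_Tl n phi -> form.
  move=> Tl; have [l Zl Zphi] := Tl_central_form (@soa_prime _ _ _ stdU U1)
    (@soa_add_self_eq0 _ _ _ stdU U1) phiD Tl ef e0 f0 Ce Cf.
  apply: form_of Zl Zphi _ => lambda mu phiE a1 a2 s a12.
  by rewrite (Tl _ _ _ a12) (lie_p_form_l phiE).
have form_r : cond_Tr n phi -> form.
  move=> Tr; have [l Zl Zphi] := Tr_central_form (@soa_prime _ _ _ stdU U1)
    (@soa_add_self_eq0 _ _ _ stdU U1) phiD Tr ef e0 f0 Ce Cf.
  apply: form_of Zl Zphi _ => lambda mu phiE a1 a2 s a12.
  by rewrite (Tr _ _ _ a12) (lie_p_form_r phiE).
have form_T : form -> cond_T n phi.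
  move=> [lambda [mu [phiE mu0]]]; split=> a1 a2 s a12.
    by rewrite phiE mu0 // scale0r addr0 (lie_p_form_l phiE).
  by rewrite phiE mu0 // scale0r addr0 (lie_p_form_r phiE).
tfae.
- by case.
- by move=> /form_l/form_T[].
- exact: form_r.
- exact: form_T.
Qed.
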